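(* Consider $k$-fold cross-validation with folds of size $m=n/k$ for the majority algorithm under the uniformly random-label model and 0--1 loss. For $1\le m\le n/2$ with $m\mid n$, the covariance $\mathrm{Cov}(n,m):=\mathrm{Cov}(\widehat L_1,\widehat L_2)$ of the losses on two distinct folds satisfies $$\mathrm{Cov}(n,m)=2^{-n}\sum_{j=0}^{m-1}\binom{m-1}{j}^2\binom{n-2m}{\lfloor (n-m)/2\rfloor-j}.$$
   Context: The sample $S^n=\{(x_i,y_i)\}_{i=1}^n$ is i.i.d. from a distribution $\mathcal D$ on $\mathcal X\times\{0,1\}$ with arbitrary marginal on $\mathcal X$ and labels $y_i$ that are i.i.d. $\mathrm{Ber}(1/2)$ (uniformly random labels). The majority algorithm $\mathcal A_{\mathrm{maj}}$, given a sample of size $N$ with label sum $Y$, outputs the constant hypothesis $h_0\equiv 0$ if $Y\le N/2$ and the constant hypothesis $h_1\equiv1$ if $Y>N/2$. The sample is partitioned into $k=n/m\ge2$ disjoint folds $S_1,\dots,S_k$ of size $m$; $S_{-i}=S^n\setminus S_i$; and $\widehat L_i=\frac1m\sum_{(x,y)\in S_i}\mathbf 1\{\mathcal A_{\mathrm{maj}}(S_{-i})(x)\ne y\}$. Binomial coefficients $\binom{a}{b}$ with $b<0$ or $b>a$ are zero. *)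

(* Defs.v *)
From HB Require Import structures.
From mathcomp Require Import all_boot all_order all_algebra.
From mathcomp Require Import all_classical all_reals all_analysis.
Set Implicit Arguments.
Unset Strict Implicit.
Unset Printing Implicit Defensive.

Import Order.TTheory GRing.Theory Num.Theory.
Import numFieldNormedType.Exports.
Local Open Scope classical_set_scope.
Local Open Scope ring_scope.

Definition mutually_independent d d' (T : measurableType d)
    (U : measurableType d') (R : realType) (P : probability T R)
    (I : finType) (Z : I -> {RV P >-> U}) : Prop :=
  forall (J : {set I}) (B : I -> set U), (forall j, measurable (B j)) ->
    P (\bigcap_(j in [set` J]) (Z j @^-1` B j)) =
    (\prod_(j in J) P (Z j @^-1` B j))%E.

Definition iid d d' (T : measurableType d) (U : measurableType d')
    (R : realType) (P : probability T R) (D : probability U R)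
    (I : finType) (Z : I -> {RV P >-> U}) : Prop :=
  mutually_independent Z /\
  forall (j : I) (B : set U), measurable B -> distribution P (Z j) B = D B.

(* [D] is a law on X * {0,1} (labels encoded as booleans). Only the marginal
   law of the label is prescribed, so independence of the label from the
   feature is the special case where [D] is a product measure. *)
Definition uniform_labels d (X : measurableType d) (R : realType)
    (D : probability (X * bool)%type R) : Prop :=
  forall B : set bool, pushforward D snd B = bernoulli_prob (2^-1 : R) B.

Definition majority (X : Type) (s : seq (X * bool)) : X -> bool :=
  if (2 * (\sum_(z <- s) nat_of_bool z.2) <= size s)%N
  then fun=> false else fun=> true.

(* A map [fold : 'I_n -> 'I_k] encodes a partition of the sample indices into
   labelled folds: fold [i] is the fibre of [fold] over [i]. *)
Definition balanced_folds (n k m : nat) (fold : 'I_n -> 'I_k) : Prop :=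
  forall i : 'I_k, #|[pred j | fold j == i]| = m.

Definition training_sample (X : Type) (n k : nat) (fold : 'I_n -> 'I_k)
    (z : 'I_n -> X * bool) (i : 'I_k) : seq (X * bool) :=
  [seq z j | j <- enum 'I_n & fold j != i].

Definition fold_loss (R : realType) (X : Type)
    (A : seq (X * bool) -> X -> bool) (n k m : nat) (fold : 'I_n -> 'I_k)
    (z : 'I_n -> X * bool) (i : 'I_k) : R :=
  m%:R^-1 * \sum_(j < n | fold j == i)
    (A (training_sample fold z i) (z j).1 != (z j).2)%:R.

(* Binomial coefficient with an integer lower index, zero when it is negative:
   truncated subtraction in 'C(a, p - q) would give 1 instead of 0 for p < q. *)
Definition binz (a : nat) (b : int) : nat :=
  if b is Posz c then 'C(a, c) else 0%N.

(* Main.v *)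
Require Import Defs.
From HB Require Import structures.
From mathcomp Require Import all_boot all_order all_algebra.
From mathcomp Require Import all_classical all_reals all_analysis.
From mathcomp Require Import ring lra zify.
Import Order.TTheory GRing.Theory Num.Theory.
Import numFieldNormedType.Exports.

(** The majority vote is a constant hypothesis, so a fold loss depends on the
    sample only through the set S of indices labelled 1, which is uniform over
    all subsets of 'I_n ([label_uniform]).  For a fold A of size m and
    q = (n - m) / 2 rounded down, the centred loss is

      L_A - 1/2 = (2m)^-1 * vote(|S \ A|) * (2 |S n A| - m),

    where the vote on the training labels is 1 when |S \ A| <= q and -1
    otherwise ([fold_loss_majority]).  The vote and the factor 2 |S n A| - m
    depend on disjoint sets of labels and the second one has mean zero, hence
    every fold loss has mean 1/2 ([sum_cube_vote_centred]).

    For two disjoint folds A and B, let C be the set of remaining indices, with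
    a = |S n A|, b = |S n B|, c = |S n C|.  The product of the centred losses is
    (2m)^-2 times

      [vote(b + c) (2a - m)] [vote(a + c) (2b - m)]
        = [vote(a + c) (2a - m)] [vote(b + c) (2b - m)].

    Swapping the two votes makes each bracket depend on a single fold once c
    is given, so the sum over the labels of A and B is the square of

      sum_a 'C(m, a) vote(a + c) (2a - m) = - 2 m 'C(m - 1, q - c),

    a telescoping sum ([sum_centred_bin], [sum_vote_centred_bin]).  Summing this
    square over the labels of C and substituting j = q - c gives the formula
    ([sum_cube_vote_product]). *)

Local Open Scope ring_scope.

(** * Sums over the subsets of a finite set *)

Section SubsetSums.
(* The names setDE, setIA, ... denote the lemmas on finite sets here. *)
Import boot.fintype boot.finset.

Lemma card_set_type (I : finType) : #|{set I}| = (2 ^ #|I|)%N.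
Proof. by rewrite -[in RHS]cardsT -card_powerset powersetT cardsT. Qed.

Lemma sum_subset_card (V : nmodType) (I : finType) (A : {set I}) (g : nat -> V) :
  \sum_(Q : {set I} | Q \subset A) g #|Q| =
  \sum_(a < #|A|.+1) g a *+ 'C(#|A|, a).
Proof.
rewrite (partition_big (fun Q : {set I} => inord #|Q| : 'I_#|A|.+1) predT) //=.
apply: eq_bigr => a _; rewrite -cards_draws -sumr_const.
have cardE (Q : {set I}) :
    (Q \subset A) && (inord #|Q| == a) = (Q \subset A) && (#|Q| == a).
  by apply: andb_id2l => sQA; rewrite -val_eqE /= inordK // ltnS subset_leq_card.
under eq_bigl => Q do rewrite cardE.
under [RHS]eq_bigl => Q do rewrite !inE.
by apply: eq_bigr => Q /andP[_ /eqP->].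
Qed.

(** A subset S of D is the same as the pair of S n A and S \ A. *)
Lemma sum_subset_split (V : nmodType) (I : finType) (A D : {set I})
    (G : {set I} -> {set I} -> V) : A \subset D ->
  \sum_(S : {set I} | S \subset D) G (S :&: A) (S :\: A) =
  \sum_(Q : {set I} | Q \subset A) \sum_(S : {set I} | S \subset D :\: A) G Q S.
Proof.
move=> sAD; rewrite pair_big /=.
rewrite (reindex_onto (fun p : {set I} * {set I} => p.1 :|: p.2)
   (fun S => (S :&: A, S :\: A))) /=; last by move=> S _; rewrite setID.
have key (p : {set I} * {set I}) :
  (p.1 :|: p.2 \subset D) && (((p.1 :|: p.2) :&: A, (p.1 :|: p.2) :\: A) == p)
  = (p.1 \subset A) && (p.2 \subset D :\: A).
  case: p => Q S /=; rewrite xpair_eqE subUset subsetD.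
  apply/idP/idP.
    case/and3P=> /andP[QD SD] /eqP QE /eqP SE; rewrite SD -{1}QE subsetIr /=.
    by rewrite disjoints_subset -SE setDE subsetIr.
  case/and3P=> QA SD dSA; rewrite (subset_trans QA sAD) SD /= setIUl setDUl.
  rewrite (setIidPl QA) (disjoint_setI0 dSA) setU0 eqxx /=.
  by move: (QA); rewrite -setD_eq0 => /eqP->; rewrite set0U (setDidPl dSA).
under eq_bigl => p do rewrite key.
apply: eq_bigr => -[Q S]; rewrite -key => /andP[_ /eqP/=[QE SE]].
by rewrite QE SE.
Qed.

Lemma sum_subset_block (V : nmodType) (I : finType) (A D : {set I})
    (G : nat -> {set I} -> V) : A \subset D ->
  \sum_(S : {set I} | S \subset D) G #|S :&: A| (S :\: A) =
  \sum_(a < #|A|.+1) (\sum_(S : {set I} | S \subset D :\: A) G a S) *+ 'C(#|A|, a).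
Proof.
move=> sAD; rewrite (sum_subset_split _ _ _ _ (fun Q S => G #|Q| S) sAD).
exact: (sum_subset_card _ _ _
  (fun a => \sum_(S : {set I} | S \subset D :\: A) G a S)).
Qed.

(** Peeling off the block C first leaves its sum outermost, which is the order
    in which the sums over A and B factor later. *)
Lemma sum_three_blocks (V : nmodType) (I : finType) (A B : {set I})
    (g : nat -> nat -> nat -> V) : [disjoint A & B] ->
  let C := ~: (A :|: B) in
  \sum_(S : {set I}) g #|S :&: A| #|S :&: B| #|S :&: C| =
  \sum_(c < #|C|.+1) (\sum_(a < #|A|.+1) (\sum_(b < #|B|.+1)
     g a b c *+ 'C(#|B|, b)) *+ 'C(#|A|, a)) *+ 'C(#|C|, c).
Proof.
move=> dAB C.
have AsubC : A \subset ~: C by rewrite setCK subsetUl.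
have BE : ~: C :\: A = B.
  by rewrite setCK setDUl setDv set0U; apply/setDidPl; rewrite disjoint_sym.
have capDC (S Q : {set I}) : Q \subset ~: C -> (S :\: C) :&: Q = S :&: Q.
  by move=> QC; rewrite setDE -setIA; congr (_ :&: _); exact/setIidPr.
pose G c (S : {set I}) := g #|S :&: A| #|S :&: B| c.
transitivity (\sum_(S : {set I} | S \subset [set: I]) G #|S :&: C| (S :\: C)).
  apply: eq_big => [S|S _]; first by rewrite subsetT.
  by rewrite /G !capDC // setCK subsetUr.
rewrite (sum_subset_block _ _ _ _ G (subsetT C)) setTD.
apply: eq_bigr => c _; congr (_ *+ _).
pose H a (S : {set I}) := g a #|S| c.
transitivity (\sum_(S : {set I} | S \subset ~: C) H #|S :&: A| (S :\: A)).
  apply: eq_bigr => S SC; rewrite /G /H; congr (g _ #|pred_of_set _| _).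
  by rewrite -BE setIDA (setIidPl SC).
rewrite (sum_subset_block _ _ _ _ H AsubC) BE.
by apply: eq_bigr => a _; rewrite (sum_subset_card _ _ _ (g a ^~ c)).
Qed.

End SubsetSums.

(** * Binomial sums *)

(** Telescoping: the term (2a - m) 'C(m, a) equals
    m 'C(m - 1, a - 1) - m 'C(m - 1, a). *)
Lemma sum_centred_bin (R : comPzRingType) (m t : nat) : (0 < m)%N ->
  \sum_(a < t.+1) (2 * a%:R - m%:R) *+ 'C(m, a) = - (m * 'C(m.-1, t))%:R :> R.
Proof.
case: m => // m _ /=; elim: t => [|t IHt].
  by rewrite big_ord1 !bin0 muln1 mulr0 sub0r mulr1n.
rewrite big_ord_recr /= IHt -mulr_natr.
have e1 : (t.+1 * 'C(m.+1, t.+1))%:R = (m.+1 * 'C(m, t))%:R :> R.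
  by rewrite mul_bin_diag.
have e2 : ((m.+1)%:R - (t.+1)%:R) * 'C(m.+1, t.+1)%:R = (m.+1 * 'C(m, t.+1))%:R :> R.
  case: (leqP t.+1 m.+1) => tm.
    by rewrite -natrB // -natrM mul_bin_down.
  by rewrite !bin_small ?muln0 ?mulr0 // ltnW.
rewrite -e1 -e2 natrM; ring.
Qed.

Lemma binz_subn (N q j : nat) :
  binz N (Posz q - Posz j) = if (j <= q)%N then 'C(N, q - j) else 0%N.
Proof.
case: leqP => jq; first by rewrite subzn.
have: Posz q - Posz j < 0 by lia.
by case: (Posz q - Posz j).
Qed.

(** The sign 1 - 2h of the constant hypothesis h chosen by a majority rule that
    outputs 0 exactly when the number [s] of labels 1 is at most [q]. *)
Definition vote (R : pzRingType) (q s : nat) : R := if (s <= q)%N then 1 else -1.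

(** The full sum of (2a - m) 'C(m, a) vanishes; adding it turns the weights
    1 and -1 into 2 and 0, leaving twice a partial sum. *)
Lemma sum_vote_centred_bin (R : comPzRingType) (m q c : nat) : (0 < m)%N ->
  \sum_(a < m.+1) (vote R q (a + c) * (2 * a%:R - m%:R)) *+ 'C(m, a) =
  - (2 * m%:R * (binz m.-1 (Posz q - Posz c))%:R).
Proof.
move=> m0; rewrite binz_subn -mulrA -natrM.
have tot : \sum_(a < m.+1) (2 * a%:R - m%:R) *+ 'C(m, a) = 0 :> R.
  by rewrite sum_centred_bin // bin_small ?muln0 ?oppr0 // prednK.
have -> : \sum_(a < m.+1) (vote R q (a + c) * (2 * a%:R - m%:R)) *+ 'C(m, a) =
   2 * \sum_(a < m.+1 | (a + c <= q)%N) (2 * a%:R - m%:R) *+ 'C(m, a).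
  rewrite [in RHS]big_mkcond /= -[LHS]addr0 -[X in _ + X = _]tot -big_split mulr_sumr /=.
  apply: eq_bigr => a _; rewrite /vote -mulrnDl.
  case: ifP => _; first by rewrite [RHS]mulrnAr; congr (_ *+ _); ring.
  by rewrite mulN1r addNr mul0rn mulr0.
rewrite -mulrN; congr (_ * _); case: (leqP c q) => cq; last first.
  by rewrite muln0 oppr0 big_pred0 // => a; apply/negbTE; lia.
rewrite -sum_centred_bin //.
(* The bound q - c may lie on either side of m, so both sums are extended to a
   common range. *)
pose F a : R := (2 * a%:R - m%:R) *+ 'C(m, a).
rewrite (big_ord_widen_cond (m + q).+1 (fun a => a + c <= q)%N F) ?ltnS ?leq_addr //.
rewrite (big_ord_widen (m + q).+1 F); last by lia.
rewrite big_mkcond [RHS]big_mkcond /=; apply: eq_bigr => a _; rewrite /F.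
case: (ltnP a m.+1) => am; last by rewrite andbF bin_small // mulr0n if_same.
by rewrite andbT (_ : (a < (q - c).+1)%N = (a + c <= q)%N) //; lia.
Qed.

(** The substitution j = q - c turns both sides into one sum over j <= q: a
    binomial coefficient or [u] vanishes on the terms added or dropped. *)
Lemma sum_bin_reverse (R : comPzRingType) (N m q : nat) (u : nat -> R) :
  (forall j, (m <= j)%N -> u j = 0) ->
  \sum_(c < N.+1) (if (c <= q)%N then u (q - c)%N else 0) *+ 'C(N, c) =
  \sum_(j < m) u j *+ binz N (Posz q - Posz j).
Proof.
move=> u0.
transitivity (\sum_(c < q.+1) u (q - c)%N *+ 'C(N, c)).
  pose F c : R := (if (c <= q)%N then u (q - c)%N else 0) *+ 'C(N, c).
  rewrite (big_ord_widen (N + q).+1 F) ?ltnS ?leq_addr //.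
  rewrite (big_ord_widen (N + q).+1 (fun c => u (q - c)%N *+ 'C(N, c))); last lia.
  rewrite big_mkcond [RHS]big_mkcond /=; apply: eq_bigr => c _; rewrite /F !ltnS.
  case: (leqP c N) => cN; case: (leqP c q) => cq //; first by rewrite mul0rn.
  by rewrite bin_small.
rewrite (reindex_inj rev_ord_inj) /=.
pose F j : R := u j *+ binz N (Posz q - Posz j).
rewrite -/(\sum_(j < m) F j) (big_ord_widen (m + q).+1 F); last lia.
transitivity (\sum_(j < q.+1) F j).
  apply: eq_bigr => j _; have jq : (j <= q)%N by rewrite -ltnS.
  by rewrite /F binz_subn jq subSS subKn.
rewrite (big_ord_widen (m + q).+1 F) ?ltnS ?leq_addl //.
rewrite big_mkcond [RHS]big_mkcond /=; apply: eq_bigr => j _; rewrite ltnS /F binz_subn.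
case: (leqP j q) => jq; case: (ltnP j m) => jm //=; by rewrite u0 // mul0rn.
Qed.

(** * Sums over all labellings *)

Section LabellingSums.
Import boot.fintype boot.finset.

(** The vote depends on the labels outside A only, and for each of their values
    the factor 2 |S n A| - |A| sums to zero over the labels in A. *)
Lemma sum_cube_vote_centred (R : comPzRingType) (I : finType) (A : {set I}) (q : nat) :
  (0 < #|A|)%N ->
  \sum_(S : {set I}) vote R q #|S :\: A| * (2 * #|S :&: A|%:R - #|A|%:R) = 0.
Proof.
move=> A0; pose G a (S : {set I}) : R := vote R q #|S| * (2 * a%:R - #|A|%:R).
transitivity (\sum_(S : {set I} | S \subset [set: I]) G #|S :&: A| (S :\: A)).
  by apply: eq_bigl => S; rewrite subsetT.
rewrite (sum_subset_block _ _ _ _ G (subsetT A)) /G.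
under eq_bigr => a _ do rewrite -mulr_suml -mulrnAr.
by rewrite -mulr_sumr sum_centred_bin // bin_small ?muln0 ?oppr0 ?mulr0 // prednK.
Qed.

(** Exchanging the two votes turns the product into one factor per fold, given
    the labels outside both folds. *)
Lemma sum_cube_vote_product (R : comPzRingType) (I : finType) (A B : {set I}) (m q : nat) :
  (0 < m)%N -> [disjoint A & B] -> #|A| = m -> #|B| = m ->
  \sum_(S : {set I}) (vote R q #|S :\: A| * (2 * #|S :&: A|%:R - m%:R)) *
                     (vote R q #|S :\: B| * (2 * #|S :&: B|%:R - m%:R)) =
  (2 * m%:R) ^+ 2 * \sum_(j < m)
    ('C(m.-1, j) ^ 2 * binz (#|I| - 2 * m) (Posz q - Posz j))%N%:R.
Proof.
move=> m0 dAB cA cB; set C := ~: (A :|: B).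
have cC : #|C| = (#|I| - 2 * m)%N.
  by rewrite cardsCs setCK cardsU (disjoint_setI0 dAB) cards0 cA cB; lia.
(* [x a c] and [x b c] are the factors of [g a b c] after exchanging votes. *)
pose x a c : R := vote R q (a + c) * (2 * a%:R - m%:R).
pose g a b c := (vote R q (b + c) * (2 * a%:R - m%:R)) *
                (vote R q (a + c) * (2 * b%:R - m%:R)).
have cardD (S Q Q' : {set I}) : [disjoint Q & Q'] ->
    #|S :\: Q| = (#|S :&: Q'| + #|S :&: ~: (Q :|: Q')|)%N.
  move=> dQ; rewrite -(cardsID Q' (S :\: Q)); congr (_ + _)%N; apply: eq_card => i.
    rewrite !inE andbAC andbC; case: (boolP (i \in Q')) => [iQ|]; rewrite ?andbF //.
    by rewrite andbT (disjointFl dQ iQ) andbT.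
  by rewrite !inE negb_or; case: (i \in S); case: (i \in Q); case: (i \in Q').
transitivity (\sum_(S : {set I}) g #|S :&: A| #|S :&: B| #|S :&: C|).
  apply: eq_bigr => S _; rewrite /g (cardD S A B) // (cardD S B A) 1?disjoint_sym //.
  by rewrite (setUC B).
rewrite (sum_three_blocks _ _ _ _ g dAB) /= -/C cA cB cC.
transitivity (\sum_(c < (#|I| - 2 * m).+1)
    ((\sum_(a < m.+1) x a c *+ 'C(m, a)) ^+ 2) *+ 'C(#|I| - 2 * m, c)).
  apply: eq_bigr => c _; congr (_ *+ _); rewrite expr2 mulr_suml.
  apply: eq_bigr => a _; rewrite mulr_sumr -sumrMnl; apply: eq_bigr => b _.
  rewrite [RHS]mulrnAl [X in _ = X *+ _]mulrnAr; congr (_ *+ _ *+ _).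
  by rewrite /g /x; ring.
pose u j : R := (2 * m%:R) ^+ 2 * ('C(m.-1, j) ^ 2)%:R.
transitivity (\sum_(c < (#|I| - 2 * m).+1)
    (if (c <= q)%N then u (q - c)%N else 0) *+ 'C(#|I| - 2 * m, c)).
  apply: eq_bigr => c _; congr (_ *+ _); rewrite sum_vote_centred_bin //.
  rewrite sqrrN exprMn binz_subn /u; case: ifP => _; first by rewrite natrX.
  by rewrite expr0n mulr0.
rewrite (sum_bin_reverse _ _ m).
  by rewrite mulr_sumr; apply: eq_bigr => j _; rewrite /u -mulrnAr -mulrnA natrM mulr_natr mulrnA.
by move=> j mj; rewrite /u bin_small ?exp0n ?mulr0 // prednK.
Qed.

End LabellingSums.

Local Open Scope classical_set_scope.

(** * The law of the labels *)

Lemma expectation_finite (R : realType) (d : measure_display)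
    (T : measurableType d) (P : probability T R) (V : finType) (y : T -> V)
    (p F : V -> R) :
  (forall v, measurable (y @^-1` [set v])) ->
  (forall v, P (y @^-1` [set v]) = (p v)%:E) ->
  ('E_P[F \o y] = (\sum_v p v * F v)%:E)%E.
Proof.
move=> my Py; rewrite unlock.
transitivity (\int[P]_w (\sum_(v : V) (F v)%:E * (\1_(y @^-1` [set v]) w)%:E))%E.
  apply: eq_integral => w _; rewrite (bigD1 (y w)) //= indicE mem_set //= mule1.
  rewrite big1 ?adde0 // => v /eqP vy; rewrite indicE memNset ?mule0 //=.
  by move=> yv; apply: vy.
have int1 v : P.-integrable setT (fun w => (\1_(y @^-1` [set v]) w)%:E).
  exact: integrable_indic.
rewrite integral_sum //; last by move=> v; exact: integrableZl.
rewrite -sumEFin; apply: eq_bigr => v _.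
rewrite integralZl // integral_indic // setIT muleC EFinM.
by congr (_ * _)%E; exact: Py.
Qed.

Definition label_set {X : Type} {n : nat} (z : 'I_n -> X * bool) : {set 'I_n} :=
  finset (fun j => (z j).2).

Section label_law.
Context (R : realType) (dT : measure_display) (T : measurableType dT)
  (P : probability T R) (dX : measure_display) (X : measurableType dX)
  (D : probability (X * bool)%type R) (n : nat)
  (Z : 'I_n -> {RV P >-> (X * bool)%type}).
Hypotheses (uD : uniform_labels D) (iidZ : iid D Z).

Let measurable_label (b : bool) : measurable (snd @^-1` [set b] : set (X * bool)%type).
Proof. by rewrite -[X in measurable X]setTI; exact: measurable_snd. Qed.

Lemma label_preimage (S : {set 'I_n}) :
  (fun w => label_set (fun j => Z j w)) @^-1` [set S] =
  \bigcap_(j in [set` [set: 'I_n]%SET]) (Z j @^-1` (snd @^-1` [set j \in S])).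
Proof.
apply/seteqP; split => w /=.
  by move=> <- j _ /=; rewrite inE.
by move=> wS; apply/setP => j; rewrite inE; apply: wS; rewrite /= inE.
Qed.

Lemma measurable_label_preimage (S : {set 'I_n}) :
  measurable ((fun w => label_set (fun j => Z j w)) @^-1` [set S]).
Proof.
rewrite label_preimage; apply: fin_bigcap_measurable => // j _.
exact: measurable_funPTI.
Qed.

(** Fixing all labels constrains each example separately, so independence gives
    a product of n marginal probabilities 1/2. *)
Lemma label_uniform (S : {set 'I_n}) :
  P ((fun w => label_set (fun j => Z j w)) @^-1` [set S]) = (2 ^- n)%:E.
Proof.
have [indep ident] := iidZ.
have half j : P (Z j @^-1` (snd @^-1` [set j \in S])) = (2^-1)%:E.
  have -> : P (Z j @^-1` (snd @^-1` [set j \in S])) = D (snd @^-1` [set j \in S]).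
    by rewrite -(ident j).
  have -> : D (snd @^-1` [set j \in S]) = pushforward D snd [set j \in S] by [].
  rewrite uD bernoulli_probE; last by apply/andP; split; lra.
  rewrite !diracE; case: (j \in S).
    by rewrite mem_set // memNset //= mule1 mule0 adde0.
  rewrite memNset // mem_set //= mule1 mule0 add0e; congr _%:E.
  by rewrite -[LHS]/(1 - 2^-1); lra.
rewrite label_preimage (indep [set: 'I_n]%SET (fun j => snd @^-1` [set j \in S])) //.
under eq_bigr => j _ do rewrite half.
by rewrite prodEFin prodr_const cardsT card_ord exprVn.
Qed.

Lemma expectation_label_set (F : {set 'I_n} -> R) :
  ('E_P[(fun w => F (label_set (fun j => Z j w)))] =
   (2 ^- n * \sum_(S : {set 'I_n}) F S)%:E)%E.
Proof.
rewrite (@expectation_finite _ _ _ _ _ (fun w => label_set (fun j => Z j w))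
  (fun=> 2 ^- n) F measurable_label_preimage label_uniform).
by rewrite mulr_sumr.
Qed.

End label_law.

(** * The fold losses *)

(** With a the number of labels 1 in the fold, the two values of the vote give
    the losses a / m and (m - a) / m, which differ from 1/2 by opposite
    amounts. *)
Lemma fold_loss_majority (R : realType) (X : Type) (n k m : nat)
    (fold : 'I_n -> 'I_k) (z : 'I_n -> X * bool) (i : 'I_k) :
  (0 < m)%N -> balanced_folds m fold ->
  let A : {set 'I_n} := finset (fun j => fold j == i) in
  let S := label_set z in
  fold_loss R (@majority X) m fold z i =
  2^-1 + (2 * m%:R)^-1 * (vote R ((n - m) %/ 2)%N #|S :\: A|%SET
     * (2 * #|S :&: A|%SET%:R - m%:R)).
Proof.
move=> m0 bal A S.
have m0R : m%:R != 0 :> R by rewrite pnatr_eq0 -lt0n.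
have cA : #|A| = m by rewrite -(bal i); apply: eq_card => j; rewrite !inE.
have sum_train (f : X * bool -> nat) :
    \sum_(x <- training_sample fold z i) f x = (\sum_(j < n | fold j != i) f (z j))%N.
  by rewrite big_map big_filter big_enum_cond.
have train_size : size (training_sample fold z i) = (n - m)%N.
  rewrite -sum1_size sum_train sum1_card; transitivity #|~: A|%SET.
    by apply: eq_card => j; rewrite !inE.
  by rewrite cardsCs finset.setCK card_ord cA.
have train_ones : (\sum_(x <- training_sample fold z i) nat_of_bool x.2)%N = #|S :\: A|%SET.
  rewrite sum_train -sum1_card big_mkcond [RHS]big_mkcond /=; apply: eq_bigr => j _.
  by rewrite !inE; case: (_ == _) => //=; case: (z j).2.
have fold_ones : \sum_(j < n | fold j == i) ((z j).2)%:R = #|S :&: A|%SET%:R :> R.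
  rewrite -sum1_card natr_sum big_mkcond [RHS]big_mkcond /=; apply: eq_bigr => j _.
  by rewrite !inE andbC; case: (_ == _) => //=; case: (z j).2.
have fold_zeros : \sum_(j < n | fold j == i) (~~ (z j).2)%:R = m%:R - #|S :&: A|%SET%:R :> R.
  rewrite -fold_ones -cA -sum1_card natr_sum.
  rewrite [X in _ = X - _](eq_bigl (fun j => fold j == i)); last by move=> j; rewrite inE.
  by rewrite -sumrB; apply: eq_bigr => j _; case: (z j).2; rewrite /= ?subrr ?subr0.
rewrite /fold_loss /majority train_ones train_size mulnC -leq_divRL // /vote.
case: ifP => _.
  rewrite (eq_bigr (fun j => ((z j).2)%:R)); last by move=> j _; case: (z j).2.
  by rewrite fold_ones; field.
rewrite (eq_bigr (fun j => (~~ (z j).2)%:R)); last by move=> j _; case: (z j).2.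
by rewrite fold_zeros; field.
Qed.

(** * The covariance of two fold losses *)

Theorem theorem8 (R : realType)
    (dT : measure_display) (T : measurableType dT) (P : probability T R)
    (dX : measure_display) (X : measurableType dX)
    (D : probability (X * bool)%type R)
    (n m : nat)
    (Z : 'I_n -> {RV P >-> (X * bool)%type})
    (fold : 'I_n -> 'I_(n %/ m)%N) (i1 i2 : 'I_(n %/ m)%N) :
  (1 <= m)%N -> (2 * m <= n)%N -> (m %| n)%N ->
  uniform_labels D ->
  iid D Z ->
  balanced_folds m fold ->
  i1 != i2 ->
  covariance P
    (fun w : T => fold_loss R (@majority X) m fold (fun j => Z j w) i1)
    (fun w : T => fold_loss R (@majority X) m fold (fun j => Z j w) i2) =
  (2 ^- n * \sum_(j < m)
     ('C(m.-1, j) ^ 2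
      * binz (n - 2 * m) (Posz ((n - m) %/ 2) - Posz j))%N%:R)%:E.
Proof.
move=> m0 _ _ uD iidZ bal i12.
pose A i : {set 'I_n} := finset (fun j => fold j == i).
pose dev i (S : {set 'I_n}) : R := vote R ((n - m) %/ 2)%N #|S :\: A i|%SET
  * (2 * #|S :&: A i|%SET%:R - m%:R).
pose L i w : R := 2^-1 + (2 * m%:R)^-1 * dev i (label_set (fun j => Z j w)).
have lossE i : (fun w : T => fold_loss R (@majority X) m fold (fun j => Z j w) i) = L i.
  by apply/funext => w; rewrite (fold_loss_majority _ _ _ _ _ fold).
have cA i : #|A i| = m by rewrite -(bal i); apply: eq_card => j; rewrite !inE.
have dA : [disjoint A i1 & A i2]%B.
  rewrite -finset.setI_eq0; apply/eqP/setP => j; rewrite !inE.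
  by case: eqP => //= ->; apply/negbTE.
have m0R : m%:R != 0 :> R by rewrite pnatr_eq0 -lt0n.
have EL i : ('E_P[L i] = (2^-1)%:E)%E.
  rewrite (@expectation_label_set _ _ _ _ _ _ _ _ _ uD iidZ
    (fun S => 2^-1 + (2 * m%:R)^-1 * dev i S)).
  rewrite big_split /= -mulr_sumr.
  have := sum_cube_vote_centred R _ (A i) ((n - m) %/ 2)%N; rewrite cA => -> //.
  rewrite mulr0 addr0 sumr_const card_set_type card_ord.
  rewrite -[X in _ * X]mulr_natr mulrCA natrX.
  by rewrite mulVf ?mulr1 // expf_neq0 // pnatr_eq0.
rewrite !lossE unlock !EL /=.
pose dd S : R := ((2 * m%:R)^-1 ^+ 2) * (dev i1 S * dev i2 S).
transitivity ('E_P[(fun w => dd (label_set (fun j => Z j w)))])%E.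
  congr expectation; apply/funext => w; rewrite /dd.
  by rewrite -[LHS]/((L i1 w - 2^-1) * (L i2 w - 2^-1)) /L; ring.
rewrite (@expectation_label_set _ _ _ _ _ _ _ _ _ uD iidZ dd) /dd -mulr_sumr.
have sum_dev := sum_cube_vote_product R _ (A i1) (A i2) m ((n - m) %/ 2)%N
  m0 dA (cA i1) (cA i2).
congr (_ * _)%:E; rewrite sum_dev card_ord mulrA -exprMn.
have two_m_neq0 : 2 * m%:R != 0 :> R by rewrite mulf_neq0 // pnatr_eq0.
by rewrite mulVf // expr1n mul1r.
Qed.
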